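(* Let $(V,R)=(V_1,R_1)\oplus(V_2,R_2)$, where $R$, $R_1$, $R_2$ are algebraic curvature tensors on $V$, $V_1$, $V_2$ respectively, and suppose that $V_1$ and $V_2$ are $g$-invariant for all $g\in G_R$. Then $G_R\cong G_{R_1}\times G_{R_2}$, the (group-theoretic) internal direct product of $G_{R_1}$ and $G_{R_2}$.
   Context: All vector spaces are real and finite-dimensional. An algebraic curvature tensor on $V$ is a 4-linear form $R:V^4\to\mathbb{R}$ with $R(x,y,z,w)=-R(y,x,z,w)$, $R(x,y,z,w)=R(z,w,x,y)$ and $R(x,y,z,w)+R(x,z,w,y)+R(x,w,y,z)=0$. Writing $(V,R)=(V_1,R_1)\oplus(V_2,R_2)$ means: $V=V_1\oplus V_2$ with $\dim V_i\ge 1$, $R(x_1,x_2,z,w)=R(x_2,x_1,z,w)=0$ for all $x_i\in V_i$ and all $z,w\in V$, and $R_i$ is the restriction of $R$ to $V_i$. The structure group is $G_R=\{A\in GL(V): R(Ax,Ay,Az,Aw)=R(x,y,z,w)\ \text{for all } x,y,z,w\in V\}$, and similarly $G_{R_i}\le GL(V_i)$. ''Internal direct product'' refers to the copies of $G_{R_1}$ and $G_{R_2}$ in $GL(V)$ obtained by extending each $g_1\in G_{R_1}$ by the identity on $V_2$ and each $g_2\in G_{R_2}$ by the identity on $V_1$. A subspace $W$ is $g$-invariant if $g(W)\subseteq W$. *)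

(* Defs.v *)
From HB Require Import structures.
From mathcomp Require Import all_boot all_order all_algebra.
From mathcomp Require Import boolp classical_sets reals.

Set Implicit Arguments.
Unset Strict Implicit.
Unset Printing Implicit Defensive.

Import GRing.Theory.
Local Open Scope ring_scope.

(* Stated for [set T] rather than with MathComp's [dprod]: the latter is only
   available for finite groups. *)
Definition is_subgroup (T : groupType) (H : set T) : Prop :=
  [/\ H 1%g,
      (forall x y, H x -> H y -> H (x * y)%g)
    & (forall x, H x -> H x^-1%g)].

Definition is_normal_in (T : groupType) (H G : set T) : Prop :=
  forall g h, G g -> H h -> H (h ^ g)%g.

Definition internal_direct_product (T : groupType) (G H1 H2 : set T) : Prop :=
  [/\ [/\ is_subgroup G, is_subgroup H1 & is_subgroup H2],
      (H1 `<=` G)%classic /\ (H2 `<=` G)%classic,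
      is_normal_in H1 G /\ is_normal_in H2 G,
      (H1 `&` H2 = [set 1%g])%classic
    & forall g, G g -> exists h1 h2, [/\ H1 h1, H2 h2 & g = (h1 * h2)%g]].

Definition isomorphic_groups (G H : groupType) : Prop :=
  exists f : {multiplicative G -> H}, bijective f.

Section GeneralLinearGroup.
Variables (K : fieldType) (V : vectType K).

Definition GL := {f : 'End(V) | lker f == 0%VS}.
HB.instance Definition _ := Choice.on GL.
HB.instance Definition _ := SubChoice.on GL.

Definition GL_lfun (A : GL) : 'End(V) := val A.
Coercion GL_lfun : GL >-> hom.

Fact GL_one_subproof : lker (\1%VF : 'End(V)) == 0%VS.
Proof. by apply/lker0P => x y; rewrite !id_lfunE. Qed.

Fact GL_mul_subproof (A B : GL) : lker (A \o B)%VF == 0%VS.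
Proof.
by apply/lker0P => x y; rewrite !comp_lfunE => /(lker0P (valP A))/(lker0P (valP B)).
Qed.

Fact GL_inv_subproof (A : GL) : lker (A^-1)%VF == 0%VS.
Proof. exact/lker0P/(can_inj (lker0_lfunVK (valP A))). Qed.

Definition GL_one : GL := Sub \1%VF GL_one_subproof.
Definition GL_mul (A B : GL) : GL := Sub (A \o B)%VF (GL_mul_subproof A B).
Definition GL_inv (A : GL) : GL := Sub (A^-1)%VF (GL_inv_subproof A).

Fact GL_mulA : associative GL_mul.
Proof. by move=> A B C; apply/val_inj; rewrite !SubK comp_lfunA. Qed.
Fact GL_mul1 : left_id GL_one GL_mul.
Proof. by move=> A; apply/val_inj; rewrite !SubK comp_lfun1l. Qed.
Fact GL_1mul : right_id GL_one GL_mul.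
Proof. by move=> A; apply/val_inj; rewrite !SubK comp_lfun1r. Qed.
Fact GL_mulV : left_inverse GL_one GL_inv GL_mul.
Proof. by move=> A; apply/val_inj; rewrite !SubK lker0_compVf ?(valP A). Qed.
Fact GL_Vmul : right_inverse GL_one GL_inv GL_mul.
Proof. by move=> A; apply/val_inj; rewrite !SubK lker0_compfV ?(valP A). Qed.

HB.instance Definition _ :=
  isGroup.Build GL GL_mulA GL_mul1 GL_1mul GL_mulV GL_Vmul.

Lemma GLM (A B : GL) x : ((A * B)%g : GL) x = A (B x).
Proof. exact: comp_lfunE. Qed.
Lemma GL1 x : (1%g : GL) x = x.
Proof. exact: id_lfunE. Qed.
Lemma GLVK (A : GL) x : A ((A^-1%g : GL) x) = x.
Proof. exact: lker0_lfunVK (valP A) x. Qed.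
Lemma GLP (A B : GL) : (forall x, A x = B x) -> A = B.
Proof. by move=> AB; apply/val_inj/lfunP. Qed.

Definition invariant_subspace (g : GL) (W : {vspace V}) : Prop :=
  (g @: W <= W)%VS.

End GeneralLinearGroup.

Section CurvatureTensor.
Variables (K : realType) (V : vectType K).
Implicit Type R : V -> V -> V -> V -> K.

Record four_linear R : Prop := {
  four_linear_1 : forall y z w, scalar (fun x => R x y z w);
  four_linear_2 : forall x z w, scalar (fun y => R x y z w);
  four_linear_3 : forall x y w, scalar (fun z => R x y z w);
  four_linear_4 : forall x y z, scalar (fun w => R x y z w) }.

Record algebraic_curvature_tensor R : Prop := {
  act_four_linear : four_linear R;
  act_antisym : forall x y z w, R x y z w = - R y x z w;
  act_pairsym : forall x y z w, R x y z w = R z w x y;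
  act_bianchi : forall x y z w, R x y z w + R x z w y + R x w y z = 0 }.

Definition structure_group R : set (GL V) :=
  [set A : GL V | forall x y z w, R (A x) (A y) (A z) (A w) = R x y z w]%classic.

Definition structure_groupType R := {A : GL V | A \in structure_group R}.
HB.instance Definition _ R := Choice.on (structure_groupType R).
HB.instance Definition _ R := SubChoice.on (structure_groupType R).

Fact structure_group_closed R : group_closed [in structure_group R].
Proof.
split=> [|A B]; rewrite !inE /=; first by move=> x y z w; rewrite !GL1.
by move=> HA HB x y z w; rewrite !GLM HA -HB !GLVK.
Qed.
HB.instance Definition _ R := SubChoice_isSubGroup.Build
  (GL V) [in structure_group R] (structure_groupType R)
  (structure_group_closed R).

End CurvatureTensor.

Section DirectSum.
Variables (K : fieldType) (V : vectType K).

Definition is_direct_sum (V1 V2 : {vspace V}) : Prop :=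
  (V1 + V2 = fullv)%VS /\ (V1 :&: V2 = 0)%VS.

Lemma is_direct_sumC V1 V2 : is_direct_sum V1 V2 -> is_direct_sum V2 V1.
Proof. by rewrite /is_direct_sum addvC capvC. Qed.

Lemma daddv_pi0 (U W : {vspace V}) x :
  (U :&: W = 0)%VS -> x \in U -> daddv_pi W U x = 0.
Proof.
move=> cUW xU; have := daddv_pi_add cUW (subvP (addvSl U W) _ xU).
by rewrite daddv_pi_id // => /eqP; rewrite addrC eq_sym -subr_eq subrr => /eqP.
Qed.

Variables V1 V2 : {vspace V}.

(* The map x1 + x2 |-> g x1 + x2; [daddv_pi U W] is the projection onto U
   along W, and [vsproj V1] is only applied to vectors of V1 here. *)
Definition extend_lfun (g : 'End(subvs_of V1)) : 'End(V) :=
  (linfun vsval \o g \o linfun (vsproj V1) \o daddv_pi V1 V2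
   + daddv_pi V2 V1)%VF.

Hypothesis dV : is_direct_sum V1 V2.

Lemma extend_lfunl g x : extend_lfun g (vsval x) = vsval (g x).
Proof.
have [_ cV] := dV; have xV : vsval x \in V1 := subvsP x.
rewrite add_lfunE !comp_lfunE !lfunE /= daddv_pi_id // vsvalK daddv_pi0 //.
by rewrite addr0.
Qed.

Lemma extend_lfunr g x : x \in V2 -> extend_lfun g x = x.
Proof.
have [_ cV] := dV => xV; have cV' : (V2 :&: V1 = 0)%VS by rewrite capvC.
by rewrite add_lfunE !comp_lfunE daddv_pi0 // daddv_pi_id // !linear0 add0r.
Qed.

Fact extend_subproof (g : GL (subvs_of V1)) : lker (extend_lfun g) == 0%VS.
Proof.
have [sV cV] := dV; rewrite -subv0; apply/subvP => x.
rewrite memv_ker memv0 => /eqP gx0.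
have /memv_addP[x1 x1V [x2 x2V Ex]] : x \in (V1 + V2)%VS by rewrite sV memvf.
have {}Ex : x = vsval (vsproj V1 x1) + x2 by rewrite vsprojK.
move: gx0; rewrite {}Ex linearD /= extend_lfunl extend_lfunr // => gx0.
have gV : vsval (g (vsproj V1 x1)) \in (V1 :&: V2)%VS.
  by rewrite memv_cap subvsP -[vsval _](addrK x2) gx0 sub0r memvN.
move: gV gx0; rewrite cV memv0 => /eqP g0; rewrite g0 add0r => ->.
rewrite addr0; have -> : vsproj V1 x1 = 0; last by rewrite linear0.
by apply/(lker0P (valP g)); rewrite [RHS]linear0; apply/val_inj.
Qed.

Definition extend (g : GL (subvs_of V1)) : GL V :=
  Sub (extend_lfun g) (extend_subproof g).

End DirectSum.

Record curvature_direct_sum (K : realType) (V : vectType K)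
    (R : V -> V -> V -> V -> K) (V1 V2 : {vspace V})
    (R1 : subvs_of V1 -> subvs_of V1 -> subvs_of V1 -> subvs_of V1 -> K)
    (R2 : subvs_of V2 -> subvs_of V2 -> subvs_of V2 -> subvs_of V2 -> K)
    : Prop := {
  cds_direct : is_direct_sum V1 V2;
  cds_dim1 : (1 <= \dim V1)%N;
  cds_dim2 : (1 <= \dim V2)%N;
  cds_vanish : forall x1 x2 z w, x1 \in V1 -> x2 \in V2 ->
    R x1 x2 z w = 0 /\ R x2 x1 z w = 0;
  cds_restr1 : forall x y z w,
    R1 x y z w = R (vsval x) (vsval y) (vsval z) (vsval w);
  cds_restr2 : forall x y z w,
    R2 x y z w = R (vsval x) (vsval y) (vsval z) (vsval w) }.

(* Main.v *)
Require Import Defs.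
From HB Require Import structures.
From mathcomp Require Import all_boot all_order all_algebra.
From mathcomp Require Import boolp classical_sets reals.

Set Implicit Arguments.
Unset Strict Implicit.
Unset Printing Implicit Defensive.

Import GRing.Theory.

(** Every mixed component of [R] vanishes, not only those with the mixed pair
    in front: pair symmetry moves a mixed pair to the back, and the Bianchi
    identity writes [R(x1,y1,z2,w2)] as minus a sum of two terms whose front pair
    is mixed. Hence [R] is the orthogonal sum of its restrictions to [V1] and [V2]
    ([curvature_splits]), and a block-diagonal map preserves [R] exactly when
    each block preserves the restriction of [R] to its summand
    ([extend_structure], [restrict_structure]).

    Invariance of [V1] and [V2] under [G_R] says that every element of [G_R] is
    block-diagonal, so [g] is determined by its two restrictions, and taking
    them is the isomorphism onto the product. For the internal product, the copy
    of [G_{R_1}] is the pointwise stabiliser of [V2] in [G_R]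
    ([extend_imageE]), and symmetrically for [G_{R_2}]. This makes the internal
    axioms immediate: a pointwise stabiliser is a subgroup, it is normal because
    the subspace that it fixes is preserved by [G_R], and a map fixing both
    summands is the identity. *)

Local Open Scope ring_scope.
Local Open Scope classical_set_scope.

(** * Curvature tensors that split along a direct sum *)

Section Splitting.
Variables (K : realType) (V : vectType K) (R : V -> V -> V -> V -> K).
Implicit Types U W : {vspace V}.

Definition splits_along U W : Prop :=
  forall x y z w x' y' z' w',
  x \in U -> y \in U -> z \in U -> w \in U ->
  x' \in W -> y' \in W -> z' \in W -> w' \in W ->
  R (x + x') (y + y') (z + z') (w + w') = R x y z w + R x' y' z' w'.

Lemma splits_alongC U W : splits_along U W -> splits_along W U.
Proof.
move=> sR x y z w x' y' z' w' xW yW zW wW x'U y'U z'U w'U.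
by rewrite (addrC x) (addrC y) (addrC z) (addrC w) sR // addrC.
Qed.

Lemma four_linearD : four_linear R ->
  [/\ forall x x' y z w, R (x + x') y z w = R x y z w + R x' y z w,
      forall x y y' z w, R x (y + y') z w = R x y z w + R x y' z w,
      forall x y z z' w, R x y (z + z') w = R x y z w + R x y z' w
    & forall x y z w w', R x y z (w + w') = R x y z w + R x y z w'].
Proof.
case=> l1 l2 l3 l4; split=> *.
- by rewrite -[X in X + _]scale1r l1 mul1r.
- by rewrite -[X in X + _]scale1r l2 mul1r.
- by rewrite -[X in X + _]scale1r l3 mul1r.
- by rewrite -[X in X + _]scale1r l4 mul1r.
Qed.

(** Of the sixteen components, the twelve with a mixed front or back pair vanish
    by hypothesis and pair symmetry, and [R(x,y,z',w')] and [R(x',y',z,w)]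
    vanish by the Bianchi identity. *)
Lemma curvature_splits U W : algebraic_curvature_tensor R ->
  (forall x x' z w, x \in U -> x' \in W -> R x x' z w = 0 /\ R x' x z w = 0) ->
  splits_along U W.
Proof.
move=> [lR _ sR bR] mix0 x y z w x' y' z' w' xU yU zU wU x'W y'W z'W w'W.
have [D1 D2 D3 D4] := four_linearD lR.
have f1 a b c d : a \in U -> b \in W -> R a b c d = 0.
  by move=> aU bW; have [] := mix0 a b c d aU bW.
have f2 a b c d : a \in U -> b \in W -> R b a c d = 0.
  by move=> aU bW; have [] := mix0 a b c d aU bW.
have b1 a b c d : a \in U -> b \in W -> R c d a b = 0.
  by move=> *; rewrite sR f1.
have b2 a b c d : a \in U -> b \in W -> R c d b a = 0.
  by move=> *; rewrite sR f2.
have UW a b c d : a \in U -> b \in U -> c \in W -> d \in W -> R a b c d = 0.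
  by move=> aU bU cW dW; have := bR a b c d; rewrite (f1 a c) // (f1 a d) // !addr0.
have WU a b c d : a \in U -> b \in U -> c \in W -> d \in W -> R c d a b = 0.
  by move=> *; rewrite sR UW.
rewrite !(D1, D2, D3, D4) !(f1 x y') // !(f2 y x') // !(b1 z w') //.
rewrite !(b2 w z') // (UW x y z' w') // (WU z w x' y') //.
by rewrite !(addr0, add0r).
Qed.

End Splitting.

Lemma direct_sum_ind (K : fieldType) (V : vectType K) (U W : {vspace V})
    (P : V -> Prop) : is_direct_sum U W ->
  (forall x y, x \in U -> y \in W -> P (x + y)) -> forall v, P v.
Proof.
case=> sUW _ PUW v; have : v \in (U + W)%VS by rewrite sUW memvf.
by case/memv_addP=> x xU [y yW ->]; apply: PUW.
Qed.

(** * Restriction to an invariant subspace *)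

Section Restriction.
Variables (K : fieldType) (V : vectType K).
Implicit Types (U W : {vspace V}) (g h : GL V).

Lemma GLKV g x : (g^-1%g : GL V) (g x) = x.
Proof. by rewrite -GLM mulVg GL1. Qed.

Lemma invariantP {g U x} : invariant_subspace g U -> x \in U -> g x \in U.
Proof. by move=> /subvP gU xU; apply/gU/memv_img. Qed.

Definition restrict_lfun U g : 'End(subvs_of U) :=
  (linfun (vsproj U) \o g \o linfun vsval)%VF.

Lemma restrict_lfunE U g x : invariant_subspace g U ->
  vsval (restrict_lfun U g x) = g (vsval x).
Proof.
by move=> gU; rewrite !comp_lfunE !lfunE /= vsprojK // (invariantP gU) ?subvsP.
Qed.

Fact restrict_subproof U g : invariant_subspace g U ->
  lker (restrict_lfun U g) == 0%VS.
Proof.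
move=> gU; apply/lker0P => x y /(congr1 vsval); rewrite !restrict_lfunE //.
by move=> /(lker0P (valP g))/val_inj.
Qed.

Definition restrict U g (gU : invariant_subspace g U) : GL (subvs_of U) :=
  Sub (restrict_lfun U g) (restrict_subproof gU).

Lemma restrictE U g (gU : invariant_subspace g U) x :
  vsval (restrict gU x) = g (vsval x).
Proof. exact: restrict_lfunE. Qed.

Lemma eq_on_direct_sum U W g h : is_direct_sum U W ->
  {in U, g =1 h} -> {in W, g =1 h} -> g = h.
Proof.
move=> dUW ghU ghW; apply/GLP; apply: (direct_sum_ind dUW) => x y xU yW.
by rewrite !linearD /= ghU ?ghW.
Qed.

Lemma extendl U W (d : is_direct_sum U W) (g : GL (subvs_of U)) x :
  extend d g (vsval x) = vsval (g x).
Proof. exact: extend_lfunl. Qed.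

Lemma extendr U W (d : is_direct_sum U W) (g : GL (subvs_of U)) x :
  x \in W -> extend d g x = x.
Proof. exact: extend_lfunr. Qed.

Lemma extend_restrictl U W (d : is_direct_sum U W) g
    (gU : invariant_subspace g U) x :
  x \in U -> extend d (restrict gU) x = g x.
Proof. by move=> xU; rewrite -(vsprojK xU) extendl restrictE. Qed.

(** The block decomposition: on each summand one factor is the identity and the
    other acts as [g]; the outer factor sees [g x], so it is here that [W] has
    to be preserved. *)
Lemma extend_restrictM U W (d : is_direct_sum U W) g
    (gU : invariant_subspace g U) (gW : invariant_subspace g W) :
  (extend d (restrict gU) * extend (is_direct_sumC d) (restrict gW))%g = g.
Proof.
apply: (eq_on_direct_sum d) => x xV; rewrite GLM.
  by rewrite (extendr (is_direct_sumC d)) ?extend_restrictl.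
by rewrite (extend_restrictl (is_direct_sumC d)) ?extendr ?(invariantP gW).
Qed.

End Restriction.

(** * Structure groups and their block decomposition *)

Section Blocks.
Variables (K : realType) (V : vectType K) (R : V -> V -> V -> V -> K).
Variables (U W : {vspace V}).
Variable RU : subvs_of U -> subvs_of U -> subvs_of U -> subvs_of U -> K.
Hypothesis RUE : forall x y z w,
  RU x y z w = R (vsval x) (vsval y) (vsval z) (vsval w).

Lemma restrict_structure g (gU : invariant_subspace g U) :
  structure_group R g -> structure_group RU (restrict gU).
Proof. by move=> gR x y z w; rewrite !RUE !restrictE gR. Qed.

Hypothesis dUW : is_direct_sum U W.
Hypothesis sR : splits_along R U W.

Lemma extend_structure g :
  structure_group RU g -> structure_group R (extend dUW g).
Proof.
move=> gR; do 4! apply: (direct_sum_ind dUW) => [?? /vsprojK <- ?].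
by rewrite !linearD /= !extendl !extendr // !sR ?subvsP // -!RUE gR.
Qed.

Definition pointwise_stabiliser : set (GL V) :=
  [set g | structure_group R g /\ {in W, g =1 id}].

(** This replaces the explicit copy of the structure group of [U] by a
    description from which the group axioms and normality can be read off. An
    element of [G_R] fixing [W] pointwise is the extension of its own restriction
    to [U]. *)
Lemma extend_imageE :
  (forall g, structure_group R g -> invariant_subspace g U) ->
  extend dUW @` structure_group RU = pointwise_stabiliser.
Proof.
move=> inv; apply/seteqP; split=> [_ [g gR <-]|g [gR gW]].
  by split=> [|x xW]; [apply: extend_structure | apply: extendr].
exists (restrict (inv g gR)); first exact: restrict_structure.
apply: (eq_on_direct_sum dUW) => x xV; first exact: extend_restrictl.
by rewrite extendr ?gW.
Qed.

Lemma structure_group_subgroup : is_subgroup (structure_group R).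
Proof.
split=> [x y z w|g h gR hR x y z w|g gR x y z w].
- by rewrite !GL1.
- by rewrite !GLM gR hR.
- by rewrite -gR !GLVK.
Qed.

Lemma pointwise_stabiliser_subgroup : is_subgroup pointwise_stabiliser.
Proof.
have [R1 RM RV] := structure_group_subgroup; split.
- by split=> // x _; rewrite GL1.
- move=> g h [gR gW] [hR hW]; split=> [|x xW]; first exact: RM.
  by rewrite GLM hW ?gW.
- move=> g [gR gW]; split=> [|x xW]; first exact: RV.
  by rewrite -[in LHS](gW x xW) GLKV.
Qed.

(** For [x] in [W], the vector [g x] is still in [W], hence is fixed by [h], so
    that [g^-1 h g x = x]. *)
Lemma pointwise_stabiliser_normal :
  (forall g, structure_group R g -> invariant_subspace g W) ->
  is_normal_in pointwise_stabiliser (structure_group R).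
Proof.
have [_ RM RV] := structure_group_subgroup.
move=> inv g h gR [hR hW]; split=> [|x xW].
  by rewrite /conjg; apply: (RM); [apply: RV | apply: RM].
by rewrite /conjg !GLM hW ?GLKV // (invariantP (inv g gR)).
Qed.

Hypothesis invU :
  forall g, structure_group R g -> invariant_subspace g U.

Definition structure_restriction (A : structure_groupType R) :
    structure_groupType RU :=
  Sub (restrict (invU (set_mem (valP A))))
      (mem_set (restrict_structure _ (set_mem (valP A)))).

Lemma structure_restrictionE A x :
  vsval ((val (structure_restriction A) : GL _) x) =
  (val A : GL V) (vsval x).
Proof. exact: restrictE. Qed.

Lemma structure_restrictionM :
  {morph structure_restriction : A B / (A * B)%g}.
Proof.
move=> A B; apply/val_inj/GLP => x; apply/val_inj.
rewrite [LHS]structure_restrictionE !gmulfM.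
by rewrite [RHS](congr1 vsval (GLM _ _ x)) !structure_restrictionE GLM.
Qed.

End Blocks.

Theorem corollary1p7 (K : realType) (V : vectType K)
    (R : V -> V -> V -> V -> K) (V1 V2 : {vspace V})
    (R1 : subvs_of V1 -> subvs_of V1 -> subvs_of V1 -> subvs_of V1 -> K)
    (R2 : subvs_of V2 -> subvs_of V2 -> subvs_of V2 -> subvs_of V2 -> K)
    (actR : algebraic_curvature_tensor R)
    (actR1 : algebraic_curvature_tensor R1)
    (actR2 : algebraic_curvature_tensor R2)
    (dR : curvature_direct_sum R R1 R2)
    (inv1 : forall g, structure_group R g -> invariant_subspace g V1)
    (inv2 : forall g, structure_group R g -> invariant_subspace g V2) :
  isomorphic_groups (structure_groupType R)
    (structure_groupType R1 * structure_groupType R2)%type /\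
  internal_direct_product (structure_group R)
    (extend (cds_direct dR) @` structure_group R1)
    (extend (is_direct_sumC (cds_direct dR)) @` structure_group R2).
Proof.
have sR := curvature_splits actR (cds_vanish dR).
set d := cds_direct dR; set d' := is_direct_sumC d.
have RE1 := cds_restr1 dR; have RE2 := cds_restr2 dR.
have ext1 := extend_structure RE1 d sR.
have ext2 := extend_structure RE2 d' (splits_alongC sR).
have subR := structure_group_subgroup R; have [_ RM _] := subR.
split; last first.
  rewrite (extend_imageE RE1) // (extend_imageE RE2) //;
    last exact: splits_alongC.
  split.
  - by split=> //; apply: pointwise_stabiliser_subgroup.
  - by split=> g [].
  - by split; apply: pointwise_stabiliser_normal.
  - apply/seteqP; split=> [g [[_ g2] [_ g1]] /=|_ ->].
      by apply: (eq_on_direct_sum d) => x xV; rewrite GL1;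
        [apply: g1 | apply: g2].
    by split; [case: (pointwise_stabiliser_subgroup R V2)
              | case: (pointwise_stabiliser_subgroup R V1)].
  - move=> g gR; exists (extend d (restrict (inv1 g gR))).
    exists (extend d' (restrict (inv2 g gR))); rewrite extend_restrictM.
    split=> //; split=> [|x xV]; try by rewrite extendr.
      exact/ext1/restrict_structure.
    exact/ext2/restrict_structure.
pose f A :=
  (structure_restriction RE1 inv1 A, structure_restriction RE2 inv2 A).
have fM : {morph f : A B / (A * B)%g}.
  by move=> A B; rewrite /f !structure_restrictionM.
pose F : {multiplicative structure_groupType R ->
    (structure_groupType R1 * structure_groupType R2)%type} :=
  HB.pack f (isMultiplicative.Build _ _ f fM).
have hP (p : structure_groupType R1 * structure_groupType R2) :
    (extend d (val p.1) * extend d' (val p.2))%g \in structure_group R.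
  by apply/mem_set/RM; [apply/ext1/set_mem/valP | apply/ext2/set_mem/valP].
(* The inverse reassembles the block-diagonal map from its two blocks. *)
pose h p : structure_groupType R :=
  Sub (extend d (val p.1) * extend d' (val p.2))%g (hP p).
have hE p x : (val (h p) : GL V) x =
    extend d (val p.1) (extend d' (val p.2) x) by rewrite SubK GLM.
exists F; exists h => [A|[A B]].
  exact/val_inj/extend_restrictM.
congr pair; apply/val_inj/GLP => x; apply/val_inj.
  by rewrite [LHS]structure_restrictionE hE (extendr d') ?subvsP ?extendl.
by rewrite [LHS]structure_restrictionE hE extendl (extendr d) ?subvsP.
Qed.
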